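(* Let $n,m\geq 1$ be integers and let $d\in\mathbb{R}$ with $d\neq 0$. Let $\mu$ be a measure on $\mathbb{R}^n$, equipped with its Borel $\sigma$-algebra, which is homogeneous of degree $d$, i.e. $\mu(\lambda A)=\lambda^d\mu(A)$ for every measurable $A\subset\mathbb{R}^n$ and all $\lambda>0$. Let $F:\mathbb{R}^n\to\mathbb{R}^m$ be a measurable function that is homogeneous of degree $0$ (scale-invariant), i.e. $F(\lambda x)=F(x)$ for all $x\in\mathbb{R}^n$ and all $\lambda>0$. Then for every measurable set $J\subset\mathbb{R}^m$, $$\mu\bigl(F^{-1}(J)\bigr)\in\{0,+\infty\}.$$
   Context: For a set $A$ and $\lambda>0$, $\lambda A=\{\lambda x\mid x\in A\}$. Measures take values in $[0,+\infty]$; measurability on $\mathbb{R}^m$ is with respect to the Borel $\sigma$-algebra. *)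

(* Defs.v *)
From HB Require Import structures.
From mathcomp Require Import all_boot all_order all_algebra.
From mathcomp Require Import all_classical all_reals all_analysis.
Import Order.TTheory GRing.Theory Num.Theory numFieldNormedType.Exports.

Set Implicit Arguments.
Unset Strict Implicit.
Unset Printing Implicit Defensive.

Local Open Scope classical_set_scope.
Local Open Scope ring_scope.

(* The library puts no sigma-algebra on ['rV[R]_n]. This is a notation, so that
   the measurable structure is found by inference; its points are convertible
   to row vectors. *)
Notation borel_rV R n := (g_sigma_algebraType (@open 'rV[R]_n)).

Definition homogeneous_measure (R : realType) (n : nat) (d : R)
    (mu : set 'rV[R]_n -> \bar R) : Prop :=
  forall (A : set (borel_rV R n)) (lambda : R), measurable A -> 0 < lambda ->
    mu [set lambda *: (x : 'rV[R]_n) | x in A] = ((lambda `^ d)%:E * mu A)%E.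

Definition scale_invariant (R : realType) (n m : nat)
    (F : 'rV[R]_n -> 'rV[R]_m) : Prop :=
  forall (x : 'rV[R]_n) (lambda : R), 0 < lambda -> F (lambda *: x) = F x.

(* Main.v *)
Require Import Defs.
From mathcomp Require Import all_boot all_order all_algebra.
From mathcomp Require Import all_classical all_reals all_analysis.
Import Order.TTheory GRing.Theory Num.Theory numFieldNormedType.Exports.
Local Open Scope classical_set_scope.
Local Open Scope ring_scope.

(** The set [F @^-1] J[is a cone: dilation by any positive factor maps it onto itself
    (]scale_invariant_preimage[). Homogeneity for the single dilation by 2 then gives]x = 2
    [^ d * x] for its measure [x]. Since [d != 0], the factor differs from 1 ([powR2_neq1]), which
    leaves only 0 and [+oo] ([mule_fixed]). *)

Lemma scale_invariant_preimage (R : realType) (n m : nat)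
    (F : 'rV[R]_n -> 'rV[R]_m) (J : set 'rV[R]_m) (lambda : R) :
  scale_invariant F -> 0 < lambda ->
  [set lambda *: x | x in F @^-1` J] = F @^-1` J.
Proof.
move=> hF l0; apply/seteqP; split => [_ [x Jx <-]|x Jx] /=.
  by rewrite hF.
(* Invariance under the inverse dilation keeps this witness in the preimage. *)
exists (lambda^-1 *: x); first by rewrite /= hF ?invr_gt0.
by rewrite scalerA divff ?scale1r ?gt_eqF.
Qed.

Lemma powR2_neq1 (R : realType) (d : R) : d != 0 -> 2 `^ d != 1.
Proof.
move=> d0; apply/eqP => /(congr1 (@ln R)); rewrite ln_powR ln1 => /eqP.
by rewrite mulf_eq0 (negbTE d0) /= gt_eqF // ln_gt0 // ltr1n.
Qed.

(** For finite [x] the equation reads [(1 - c) * x = 0], and [1 - c] is nonzero; nonnegativity rules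
    out [-oo]. *)
Lemma mule_fixed (R : realType) (c : R) (x : \bar R) :
  c != 1 -> (0 <= x)%E -> x = (c%:E * x)%E -> x = 0%E \/ x = +oo%E.
Proof.
move=> c1; case: x => [r| |] // _; last by right.
move=> [] /eqP; rewrite -subr_eq0 -[X in X - _]mul1r -mulrBl mulf_eq0.
by rewrite subr_eq0 eq_sym (negbTE c1) => /eqP ->; left.
Qed.

Theorem corollary6p2 (R : realType) (n m : nat) (hn : (0 < n)%N) (hm : (0 < m)%N)
    (d : R) (hd : d != 0)
    (mu : {measure set (borel_rV R n) -> \bar R})
    (hmu : homogeneous_measure d mu)
    (F : borel_rV R n -> borel_rV R m)
    (mF : measurable_fun [set: borel_rV R n] F)
    (hF : scale_invariant F)
    (J : set (borel_rV R m)) (mJ : measurable J) :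
  mu (F @^-1` J) = 0%E \/ mu (F @^-1` J) = +oo%E.
Proof.
have mA : measurable (F @^-1` J) by rewrite -[X in measurable X]setTI; exact: mF.
(* The choice of 2 is arbitrary: any positive ratio other than 1 would serve. *)
apply: (mule_fixed _ (2 `^ d)); [exact: powR2_neq1|exact: measure_ge0|].
by rewrite -hmu // scale_invariant_preimage.
Qed.
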